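(* Let $F(z,m_1,m_2,m_3,y)(t_1,t_2)$ be the generating series of $T$-equivariant Euler characteristics over the Hilbert schemes $(\mathbb{C}^2)^{[n]}$ defined in the context. Then $$F(z,m_1,m_2,m_3,0)(t_1,t_2)=\exp\bigg(\sum_{n\ge1}-\frac{z^n}{n}\,\frac{(1-m_1^n)(1-m_2^n)}{(1-t_1^{-n})(1-t_2^{-n})}\bigg)$$ as power series in $z$ whose coefficients are rational functions in the remaining variables.
   Context: A two-dimensional partition $\lambda$ is a finite (possibly empty) nonincreasing sequence of positive integers $(\lambda_1,\lambda_2,\dots)$, identified with the set of boxes $\{(b_1,b_2)\in\mathbb{Z}_{\ge 0}^2 : b_2\le \lambda_{b_1+1}-1\}$. $|\lambda|$ is the number of boxes, $\lambda^t=\{(b_2,b_1):(b_1,b_2)\in\lambda\}$. For a box $\square=(b_1,b_2)\in\lambda$, $a(\square)=\lambda_{b_1+1}-b_2-1$ and $l(\square)=\lambda^t_{b_2+1}-b_1-1$. Let $T=\mathrm{diag}(t_1,t_2)$ act on $\mathbb{C}^2$ by scaling the coordinate axes with weights $t_1,t_2$ (so the coordinate functions have weights $t_1^{-1},t_2^{-1}$), and consider the induced action on the Hilbert scheme of $n$ points $(\mathbb{C}^2)^{[n]}$. $\mathcal{O}^{[n]}$ is the rank $n$ tautological bundle with fiber $H^0(\mathcal{O}_Y)$ over $Y\in(\mathbb{C}^2)^{[n]}$. For a vector bundle $\mathcal{V}$, $\Lambda^\bullet_m\mathcal{V}=\sum_{i\ge0}(-m)^i\Lambda^i\mathcal{V}$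 and $\mathrm{Sym}^\bullet_y\mathcal{V}=\sum_{i\ge 0}y^i\mathrm{Sym}^i\mathcal{V}$. Equivariant Euler characteristics are identified with their characters, which are rational functions on $T$. Define $$F(z,m_1,m_2,m_3,y)(t_1,t_2)=\sum_{n\ge0}(-z)^n\chi\Big((\mathbb{C}^2)^{[n]},\Lambda^\bullet_{m_1}(\mathcal{O}^{[n]})^\vee\otimes\Lambda^\bullet_{m_2}(\mathcal{O}^{[n]})^\vee\otimes\Lambda^\bullet_{m_3y}\mathcal{O}^{[n]}\otimes\mathrm{Sym}^\bullet_y\mathcal{O}^{[n]}\otimes\Lambda^n\mathcal{O}^{[n]}\Big).$$ By equivariant localization this equals $$\sum_\lambda\frac{z^{|\lambda|}}{\Lambda^\bullet(T_\lambda^\vee)}\prod_{(b_1,b_2)\in\lambda}\frac{(1-m_1t_1^{b_1}t_2^{b_2})(1-m_2t_1^{b_1}t_2^{b_2})(1-m_3y\,t_1^{-b_1}t_2^{-b_2})}{y-t_1^{b_1}t_2^{b_2}},$$ where the sum is over all two-dimensional partitions, $T_\lambda=\sum_{\square\in\lambda}\big(t_1^{-l(\square)}t_2^{a(\square)+1}+t_1^{l(\square)+1}t_2^{-a(\square)}\big)$ is the tangent character at the fixed point indexed by $\lambda$, $V^\vee$ is obtained from $V$ by inverting $t_1,t_2$, and $\Lambda^\bullet(\sum_i u_i)=\prod_i(1-u_i)$ for weights $u_i$. $F$ is regarded as a power series in $y$ and $z$ with coefficients rational in $m_1,m_2,m_3,t_1,t_2$. *)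

(* Defs.v *)
From mathcomp Require Import all_boot all_order all_algebra.
From mathcomp Require Import fraction mpoly.
Set Implicit Arguments.
Unset Strict Implicit.
Unset Printing Implicit Defensive.
Import GRing.Theory.
Local Open Scope ring_scope.

(* A partition is the finite sequence of its parts. *)
Definition is_partition (l : seq nat) : bool :=
  sorted geq l && (0%N \notin l).

Definition boxes (l : seq nat) : seq (nat * nat) :=
  [seq (b1, b2) | b1 <- iota 0 (size l), b2 <- iota 0 (nth 0%N l b1)].

Definition conj_partition (l : seq nat) : seq nat :=
  mkseq (fun j => count (fun p => j < p)%N l) (head 0%N l).

(* Subtraction is truncated, which is harmless for a box of l. *)
Definition arm (l : seq nat) (b : nat * nat) : nat :=
  (nth 0 l b.1 - b.2 - 1)%N.
Definition leg (l : seq nat) (b : nat * nat) : nat :=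
  (nth 0 (conj_partition l) b.2 - b.1 - 1)%N.

(* The weight (a, b) is the character t1 ^ a * t2 ^ b of T; a representation
   of T is given by the multiset of its weights. *)
Definition weight : Type := (int * int)%type.

Definition dual (V : seq weight) : seq weight :=
  [seq (- w.1, - w.2) | w <- V].

(* Fiber at l of the tautological bundle: the monomials x1^b1 x2^b2, for
   (b1, b2) a box of l, form a basis of H^0(O_Y). *)
Definition taut (l : seq nat) : seq weight :=
  [seq (- (b.1%:Z), - (b.2%:Z)) | b <- boxes l].

Definition tangent (l : seq nat) : seq weight :=
  [seq (- (leg l b)%:Z, (arm l b)%:Z + 1) | b <- boxes l] ++
  [seq ((leg l b)%:Z + 1, - (arm l b)%:Z) | b <- boxes l].

(* Formal power series, given by their coefficients. *)
Definition fps (K : Type) : Type := nat -> K.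

Section PowerSeries.
Variable K : fieldType.

Definition fps_one : fps K := fun n => (n == 0%N)%:R.
Definition fps_mul (f g : fps K) : fps K :=
  fun n => \sum_(i < n.+1) f i * g (n - i)%N.
Definition fps_exp_nat (f : fps K) (k : nat) : fps K :=
  iter k (fps_mul f) fps_one.

(* exp f = \sum_k f ^ k / k!, for f without constant term: then f ^ k has no
   term of degree < k, so that only k <= n contributes in degree n. *)
Definition fps_exp (f : fps K) : fps K :=
  fun n => \sum_(k < n.+1) fps_exp_nat f k n / (k`!)%:R.

End PowerSeries.

Section Characters.
Variables (K : fieldType) (t1 t2 : K).

Definition ev (w : weight) : K := t1 ^ w.1 * t2 ^ w.2.

(* Character of the i-th exterior power: one weight for each i-subset of a
   weight basis of V. *)
Definition ext_pow (i : nat) (V : seq weight) : K :=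
  \sum_(A : {set 'I_(size V)} | #|A| == i) \prod_(j in A) ev (nth (0, 0) V j).

(* Character of the i-th symmetric power: one weight for each monomial of
   degree i in a weight basis of V. *)
Definition sym_pow (i : nat) (V : seq weight) : K :=
  \sum_(e : {ffun 'I_(size V) -> 'I_i.+1} | (\sum_(j < size V) e j)%N == i)
    \prod_(j < size V) ev (nth (0, 0) V j) ^+ e j.

(* Lambda^bullet_m V, for m a scalar. *)
Definition Lambda (m : K) (V : seq weight) : K :=
  \sum_(i < (size V).+1) (- m) ^+ i * ext_pow i V.

(* Lambda^bullet_(m y) V and Sym^bullet_y V, as power series in y. *)
Definition Lambda_y (m : K) (V : seq weight) : fps K :=
  fun i => (- m) ^+ i * ext_pow i V.
Definition Sym_y (V : seq weight) : fps K := fun i => sym_pow i V.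

(* Equivariant Euler characteristic over the Hilbert scheme of n points of the
   class whose restriction to the fixed point l is c l, computed by localization
   at the T-fixed points.  These are the partitions of n, all of which have
   at most n parts, each at most n. *)
Definition chi (n : nat) (c : seq nat -> K) : K :=
  \sum_(l : {bseq n of 'I_n.+1} |
        is_partition (map val l) && (sumn (map val l) == n))
    c (map val l) / \prod_(w <- dual (tangent (map val l))) (1 - ev w).

(* Restriction to the fixed point l, as a power series in y, of
   Lambda_m1 O^vee * Lambda_m2 O^vee * Lambda_(m3 y) O * Sym_y O * Lambda^n O. *)
Definition integrand (m1 m2 m3 : K) (n : nat) (l : seq nat) : fps K :=
  fun j =>
    Lambda m1 (dual (taut l)) * Lambda m2 (dual (taut l)) *
    fps_mul (Lambda_y m3 (taut l)) (Sym_y (taut l)) j * ext_pow n (taut l).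

(* genF m1 m2 m3 n j is the coefficient of z^n y^j in F. *)
Definition genF (m1 m2 m3 : K) : fps (fps K) :=
  fun n j => (-1) ^+ n * chi n (fun l => integrand m1 m2 m3 n l j).

End Characters.

(* Specialization y = 0 of a power series in z over power series in y. *)
Definition at_y0 (K : Type) (f : fps (fps K)) : fps K := fun n => f n 0%N.

(* Rational functions in the five variables m1, m2, m3, t1, t2. *)
Definition ratfun (C : numClosedFieldType) : fieldType :=
  {fraction {mpoly C[5]}}.
Definition rvar (C : numClosedFieldType) (i : 'I_5) : ratfun C :=
  FracField.tofrac ('X_i : {mpoly C[5]}).

Definition vm1 (C : numClosedFieldType) : ratfun C := rvar C (@Ordinal 5 0 isT).
Definition vm2 (C : numClosedFieldType) : ratfun C := rvar C (@Ordinal 5 1 isT).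
Definition vm3 (C : numClosedFieldType) : ratfun C := rvar C (@Ordinal 5 2 isT).
Definition vt1 (C : numClosedFieldType) : ratfun C := rvar C (@Ordinal 5 3 isT).
Definition vt2 (C : numClosedFieldType) : ratfun C := rvar C (@Ordinal 5 4 isT).

(* The power series in z inside the exponential; its sum starts at n = 1. *)
Definition log_series (K : fieldType) (m1 m2 t1 t2 : K) : fps K :=
  fun n => if n is 0%N then 0 else
    - (n%:R)^-1 * ((1 - m1 ^+ n) * (1 - m2 ^+ n)
                   / ((1 - t1 ^- n) * (1 - t2 ^- n))).

(* Main.v *)
Require Import Defs.
From mathcomp Require Import all_boot all_order all_algebra.
From mathcomp Require Import fraction mpoly ring zify.
Set Implicit Arguments.
Unset Strict Implicit.
Unset Printing Implicit Defensive.
Import GRing.Theory.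
Local Open Scope ring_scope.

(** Put t = t1^-1 and q = t2^-1.  The coefficient of z^n on either side is a
    polynomial in m1 and in m2, so it suffices to compare the two sides at the
    infinitely many points m1 = t^N, m2 = q^M with N, M >= n ([polyfun_eq],
    [genF_y0_generic]).

    At such a point the exponential is a finite product.  The quotient
    (1 - t^(N k)) (1 - q^(M k)) / ((1 - t^k) (1 - q^k)) is the k-th power sum of
    the monomials t^a q^b with a < N and b < M, so the right-hand side is the
    product of the factors 1 - z t^a q^b ([fps_exp_log_prod], [log_series_box]).
    All partitions of n fit in the N x M rectangle, so the theorem reduces to

      sum of z^|l| w(l) over l in the N x M rectangle
         = product of 1 - z t^a q^b over a < N, b < M,

    where w(l) is the contribution of the fixed point l ([box_sumE]).  This is
    the dual Cauchy identity of Macdonald polynomials at two principal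
    specializations; it is proved here by induction on the number M of columns,
    as follows.

    Sorting the boxes of each row by their leg turns the product over hooks
    into a product over rows and over pairs of rows of l ([prod_row_hooks],
    [fixed_point_contribution]); the factors with m1 = t^N cancel against one
    half of the hook factors of maximal leg.  In this form the weights of l
    and of m can be compared explicitly when l arises from m by adding one box
    to each row of a set A ([shape_weight_step]).  The ratio involves Vandermonde
    products in the variables x_i = t^i q^(l_i) with those indexed by A, or by
    its complement, multiplied by t.  A weighted sum over A of such products is
    a determinant, by multilinearity in the rows, and in the two cases that
    occur this determinant is the Vandermonde determinant times that of a
    triangular matrix.  One of these evaluations ([strip_removal_sum]) writes
    the weight of l for M + 1 columns as a sum over the shapes m obtained
    by removing a vertical strip, with weights for M columns; the other one
    ([strip_addition_sum]) sums over the strips that can be added to m.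
    Together they show that passing from M to M + 1 columns replaces z by q z
    and multiplies the sum by the product of 1 - z t^a over a < N ([box_sumS]). *)

(** * Sums over subsets of rescaled Vandermonde products *)

Definition vandermonde (K : fieldType) (N : nat) (x : 'I_N -> K) : K :=
  \prod_(i < N) \prod_(j < N | (i < j)%N) (x j - x i).

Lemma det_powers (K : fieldType) N (x : 'I_N -> K) :
  \det (\matrix_(i < N, m < N) x i ^+ m) = vandermonde x.
Proof.
rewrite -det_tr; have -> : (\matrix_(i < N, m < N) x i ^+ m)^T
  = Vandermonde N (\row_i x i) by apply/matrixP => i j; rewrite !mxE.
rewrite det_Vandermonde; apply: eq_bigr => i _; apply: eq_bigr => j _.
by rewrite !mxE.
Qed.

(** Expand every row of the determinant, which is a sum of two geometric rows,
    by multilinearity: the set A records the rows where the first one is taken. *)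
Lemma det_subset_sum (K : fieldType) N (a b x y : 'I_N -> K) :
  \sum_(A : {set 'I_N}) (\prod_i if i \in A then a i else b i)
     * vandermonde (fun i => if i \in A then x i else y i)
  = \det (\matrix_(i < N, m < N) (a i * x i ^+ m + b i * y i ^+ m)).
Proof.
rewrite /determinant.
under eq_bigr => A _ do rewrite -det_powers /determinant mulr_sumr.
rewrite exchange_big /=; apply: eq_bigr => s _.
under [in RHS]eq_bigr => i _ do rewrite mxE.
rewrite bigA_distr mulr_sumr; apply: eq_bigr => A _.
rewrite mulrCA; congr (_ * _); rewrite -big_split /=.
by apply: eq_bigr => i _; rewrite mxE; case: ifP.
Qed.

(** By [det_subset_sum] the sum is the determinant with entries
    x_i^m (t^m - w) + x_i^(m+1) (1 - c t^m).  Since 1 - c t^m vanishes in the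
    last column, the power x_i^N never occurs, and the matrix is the matrix of
    powers of x times a bidiagonal one. *)
Lemma strip_removal_sum (K : fieldType) N (t c w : K) (x : 'I_N -> K) :
  c * t ^+ N.-1 = 1 ->
  \sum_(A : {set 'I_N}) (\prod_i if i \in A then 1 - c * x i else x i - w)
     * vandermonde (fun i => if i \in A then t * x i else x i)
  = vandermonde x * \prod_(m < N) (t ^+ m - w).
Proof.
move=> ct; rewrite det_subset_sum.
pose U : 'M[K]_N := \matrix_(k, m)
  ((t ^+ m - w) *+ (k == m) + (1 - c * t ^+ m) *+ (k == m.+1 :> nat)).
have trigU : is_trig_mx U.
  apply/is_trig_mxP => i j ij; rewrite mxE.
  have /negbTE -> : i != j by rewrite -val_eqE /=; lia.
  have /negbTE -> : (i : nat) != j.+1 by lia.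
  by rewrite !mulr0n addr0.
have -> : \prod_(m < N) (t ^+ m - w) = \det U.
  rewrite det_trig //; apply: eq_bigr => i _; rewrite mxE eqxx.
  have /negbTE -> : (i : nat) != i.+1 by lia.
  by rewrite mulr0n addr0.
rewrite -det_powers -det_mulmx; congr (\det _).
apply/matrixP => i m; rewrite !mxE.
under eq_bigr => k _ do rewrite !mxE mulrDr.
rewrite big_split /= (bigD1 m) //= eqxx big1 ?addr0; last first.
  by move=> k /negbTE ->; rewrite mulr0n mulr0.
case: (ltnP m.+1 N) => mN.
  rewrite (bigD1 (Ordinal mN)) //= eqxx big1 ?addr0; last first.
    by move=> k; rewrite -val_eqE /= => /negbTE ->; rewrite mulr0n mulr0.
  rewrite !mulr1n exprMn exprS; ring.
have mE : (m : nat) = N.-1 by have := ltn_ord m; lia.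
rewrite big1 ?addr0; last first.
  move=> k _; have /negbTE -> : (k : nat) != m.+1 by have := ltn_ord k; lia.
  by rewrite mulr0n mulr0.
rewrite exprMn mE mulr1n.
transitivity (x i ^+ N.-1 * (t ^+ N.-1 - w) + x i * x i ^+ N.-1 * (1 - c * t ^+ N.-1)).
  by ring.
by rewrite ct subrr mulr0 addr0.
Qed.

(** Here the m-th column of the determinant is just (t^m + a) x_i^m. *)
Lemma strip_addition_sum (K : fieldType) N (t a : K) (y : 'I_N -> K) :
  \sum_(A : {set 'I_N}) a ^+ #|A| * vandermonde (fun i => if i \in A then y i else t * y i)
  = vandermonde y * \prod_(m < N) (t ^+ m + a).
Proof.
have E (A : {set _}) : a ^+ #|A| = \prod_(i < N) (if i \in A then a else 1).
  by rewrite -prodr_const big_mkcond.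
under eq_bigr => A _ do rewrite E.
rewrite (det_subset_sum (fun _ => a) (fun _ => 1)).
have -> : \prod_(m < N) (t ^+ m + a) = \det (diag_mx (\row_(m < N) (t ^+ m + a))).
  by rewrite det_diag; apply: eq_bigr => i _; rewrite mxE.
rewrite -det_powers -det_mulmx; congr (\det _).
apply/matrixP => i m; rewrite mul_mx_diag !mxE exprMn; ring.
Qed.

(** * Weight of a partition as a product over rows and pairs of rows *)

(** t and q are multiplicatively independent.  This is what makes the hook
    factors and the Vandermonde products of the proof nonzero. *)
Definition generic (K : fieldType) (t q : K) : Prop :=
  forall a b c d : nat, t ^+ a * q ^+ b = t ^+ c * q ^+ d -> a = c /\ b = d.

Section Generic.
Variables (K : fieldType) (t q : K).
Hypothesis gen : generic t q.

Lemma generic_neq a b c d : (a, b) != (c, d) -> t ^+ a * q ^+ b - t ^+ c * q ^+ d != 0.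
Proof.
move=> ne; rewrite subr_eq0; apply: contra ne => /eqP /gen [-> ->].
exact: eqxx.
Qed.

Lemma generic_t_neq0 : t != 0.
Proof.
apply/eqP => t0; suff [] : 1%N = 2%N /\ 0%N = 0%N by [].
by apply: gen; rewrite t0 !expr0n.
Qed.

Lemma generic_q_neq0 : q != 0.
Proof.
apply/eqP => q0; suff [] : 0%N = 0%N /\ 1%N = 2%N by [].
by apply: gen; rewrite q0 !expr0n.
Qed.

(** The two tangent weights at a box with arm [a] and leg [l] contribute this
    factor to the denominator of the localization formula. *)
Definition hook_factor (a l : nat) : K :=
  (1 - t ^- l * q ^+ a.+1) * (1 - t ^+ l.+1 * q ^- a).

Lemma hook_factor_neq0 a l : hook_factor a l != 0.
Proof.
have t0 := generic_t_neq0; have q0 := generic_q_neq0.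
rewrite mulf_neq0 //; apply/eqP => e.
- have /eqP[] : t ^+ l * q ^+ 0 - t ^+ 0 * q ^+ a.+1 != 0.
    by apply: generic_neq; apply/eqP => -[].
  rewrite expr0 mulr1 mul1r.
  rewrite -[RHS](mulr0 (t ^+ l)) -e mulrBr mulr1 mulrA divff ?mul1r //.
  by rewrite expf_neq0.
- have /eqP[] : t ^+ 0 * q ^+ a - t ^+ l.+1 * q ^+ 0 != 0.
    by apply: generic_neq; apply/eqP => -[].
  rewrite expr0 mulr1 mul1r.
  rewrite -[RHS](mulr0 (q ^+ a)) -e mulrBr mulr1 mulrCA divff ?mulr1 //.
  by rewrite expf_neq0.
Qed.

(** Correction for a box with arm [a] that lies to the right of the end of the
    [d]-th row below it.  Such a box has leg less than [d]; when its leg is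
    lowered step by step from the largest possible value, this is the change of
    the inverse hook factor from leg [d] to leg [d.-1]. *)
Definition pair_ratio (d a : nat) : K := hook_factor a d / hook_factor a d.-1.

Definition pair_weight (d k : nat) : K := \prod_(0 <= a < k) pair_ratio d a.

(** Hook factors in terms of the variables x_i = t^i q^(l_i) of two rows, whose
    quotient is a monomial q^a / t^l. *)
Lemma hook_factorE a l u w : t ^+ l * u = q ^+ a * w ->
  hook_factor a l * (u * w) = (w - q * u) * (u - t * w).
Proof.
have t0 := generic_t_neq0; have q0 := generic_q_neq0.
move=> e.
have a1 : (1 - t ^- l * q ^+ a.+1) * w = w - q * u.
  transitivity (w - q * (t ^- l * (q ^+ a * w))); first by rewrite exprS; ring.
  by rewrite -e mulKf ?expf_neq0.
have a2 : (1 - t ^+ l.+1 * q ^- a) * u = u - t * w.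
  transitivity (u - t * (q ^- a * (t ^+ l * u))); first by rewrite exprS; ring.
  by rewrite e mulKf ?expf_neq0.
by rewrite /hook_factor -a1 -a2; ring.
Qed.

Lemma pair_ratioE d k u w : (0 < d)%N -> u != 0 -> w != 0 -> t ^+ d * u = q ^+ k * w ->
  pair_ratio d k * ((w - t * q * u) * (u - w)) = (w - q * u) * (u - t * w).
Proof.
move=> d0 u0 w0 e; rewrite -(hook_factorE e) /pair_ratio.
have t0 := generic_t_neq0.
have e' : t ^+ d.-1 * u = q ^+ k * (w / t).
  apply: (mulfI t0); transitivity (t ^+ d.-1.+1 * u); first by rewrite exprS; ring.
  by rewrite prednK // e; field.
have -> : (w - t * q * u) * (u - w) = t * (hook_factor k d.-1 * (u * (w / t))).
  by rewrite (hook_factorE e'); field.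
have h0 := hook_factor_neq0 k d.-1; field.
by rewrite ?h0 ?t0 ?u0 ?w0.
Qed.

Variable N : nat.

(** What is left of the numerator at box [c] of row [i] when m1 = t^N: the factor
    1 - t^N / (t^i q^c) has cancelled against one half of the hook factor with
    arm [c] and leg [(N - i).-1], the largest possible leg in row [i]. *)
Definition row_factor (v : K) (i c : nat) : K :=
  (v - t ^+ i * q ^+ c) / (1 - t ^- (N - i).-1 * q ^+ c.+1).

Definition row_weight (v : K) (i k : nat) : K := \prod_(0 <= c < k) row_factor v i c.

(** The character of the first box to the right of row [i]. *)
Definition addable (l : 'I_N -> nat) (i : 'I_N) : K := t ^+ i * q ^+ l i.

Definition shape_weight (v : K) (l : 'I_N -> nat) : K :=
  (\prod_(i < N) row_weight v i (l i))
  * \prod_(i < N) \prod_(j < N | (i < j)%N) pair_weight (j - i) (l i - l j).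

Definition noninc (l : 'I_N -> nat) : bool :=
  [forall i : 'I_N, forall j : 'I_N, (i <= j)%N ==> (l j <= l i)%N].

Lemma nonincP l : reflect (forall i j : 'I_N, (i <= j)%N -> (l j <= l i)%N) (noninc l).
Proof.
apply: (iffP forallP) => [H i j | H i]; first by have /forallP/(_ j)/implyP := H i.
by apply/forallP => j; apply/implyP; apply: H.
Qed.

Lemma vandermonde_addable_neq0 l : noninc l -> vandermonde (addable l) != 0.
Proof.
move=> /nonincP nl; rewrite /vandermonde; apply/prodf_neq0 => i _; apply/prodf_neq0 => j ij.
by apply: generic_neq; apply/eqP => -[e _]; lia.
Qed.

Variable A : {set 'I_N}.

(** Replacing v by q v shifts the numerators of the row factors by one box.
    For a row in A the additional box carries the denominator
    1 - t^-(N-1) x_i, which the left-hand side provides. *)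
Lemma row_weight_step (v : K) (l m : 'I_N -> nat) (i : 'I_N) :
  (forall i, l i = m i + (i \in A))%N ->
  row_weight (q * v) i (l i)
    * (if i \in A then 1 - t ^- N.-1 * addable l i else addable l i - q * v)
  = (t ^+ i - q * v) * q ^+ m i * (if i \in A then -1 else 1) * row_weight v i (m i).
Proof.
have t0 := generic_t_neq0; have q0 := generic_q_neq0.
move=> lE.
(* The factors v - t^i q^c with q v for v telescope against those with v. *)
have shift k : row_weight (q * v) i k * (t ^+ i * q ^+ k - q * v)
   = (t ^+ i - q * v) * q ^+ k * row_weight v i k.
  elim: k => [|k IH]; first by rewrite /row_weight !big_geq // expr0 !mulr1 !mul1r.
  rewrite /row_weight !big_nat_recr //= -!/(row_weight _ _ _) /row_factor.
  set D := (1 - _)^-1.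
  transitivity (- (row_weight (q * v) i k * (t ^+ i * q ^+ k - q * v)) * D
     * q * (t ^+ i * q ^+ k - v)).
    by rewrite exprS; ring.
  by rewrite IH exprS; ring.
rewrite lE /addable lE; case: (boolP (i \in A)) => iA; rewrite ?addn0 ?addn1; last first.
  by rewrite shift mulr1.
rewrite /row_weight big_nat_recr //= -!/(row_weight _ _ _) /row_factor.
have -> : t ^- N.-1 * (t ^+ i * q ^+ (m i).+1) = t ^- (N - i).-1 * q ^+ (m i).+1.
  rewrite mulrA; congr (_ * _).
  have -> : N.-1 = ((N - i).-1 + i)%N by have := ltn_ord i; lia.
  by rewrite exprD invfM -mulrA mulVf ?mulr1 // expf_neq0.
set D := 1 - _.
have D0 : D != 0.
  apply: contraNneq (hook_factor_neq0 (m i) (N - i).-1).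
  by rewrite /hook_factor -/D => ->; rewrite mul0r.
transitivity (- (row_weight (q * v) i (m i) * (t ^+ i * q ^+ m i - q * v)) * (D / D)).
  by ring.
by rewrite shift divff //; ring.
Qed.

(** The pair weight changes only if exactly one of the two rows receives a box,
    and then by a single [pair_ratio].  By [pair_ratioE] its numerator and
    denominator are matched by the two rescaled and the two plain Vandermonde
    factors of the pair.
    The powers of t are placed so that the four cases read the same, with a
    correction [tau i * tau j] that is a product over rows. *)
Lemma pair_weight_step (l m : 'I_N -> nat) (i j : 'I_N) :
  let tau i := if i \in A then t else 1 in
  let x' i := if i \in A then t * addable l i else addable l i in
  let y' i := if i \in A then addable m i else t * addable m i in
  (forall i, l i = m i + (i \in A))%N -> noninc m -> noninc l -> (i < j)%N ->
  pair_weight (j - i) (l i - l j) * (x' j - x' i) * (addable m j - addable m i) * t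
  = pair_weight (j - i) (m i - m j) * (tau i * tau j)
      * (y' j - y' i) * (addable l j - addable l i).
Proof.
have t0 := generic_t_neq0; have q0 := generic_q_neq0.
move=> tau x' y' lm /nonincP nm /nonincP nl ij.
have mij := nm _ _ (ltnW ij); have lij := nl _ _ (ltnW ij).
have d0 : (0 < j - i)%N by rewrite subn_gt0.
have lE k : addable l k = if k \in A then q * addable m k else addable m k.
  rewrite /addable lm; case: ifP => _; rewrite ?addn0 ?addn1 ?exprS //; ring.
have y0 (k : 'I_N) : addable m k != 0 by rewrite mulf_neq0 ?expf_neq0.
have dE : t ^+ (j - i) * addable m i * q ^+ m j = q ^+ m i * addable m j.
  rewrite /addable -[in t ^+ j](subnK (ltnW ij)) exprD; ring.
rewrite /x' /y' /tau !lE; move: lij; rewrite !lm.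
case: (boolP (i \in A)) => iA; case: (boolP (j \in A)) => jA;
  rewrite ?addn0 ?addn1 => lij.
- by rewrite subSS; ring.
- rewrite subSn // /pair_weight big_nat_recr //= -/(pair_weight _ _).
  have e : t ^+ (j - i) * addable m i = q ^+ (m i - m j) * addable m j.
    apply: (mulIf (expf_neq0 (m j) q0)); rewrite dE -[in q ^+ m i](subnK mij) exprD; ring.
  have := pair_ratioE d0 (y0 i) (y0 j) e.
  set r := pair_ratio _ _; set p := pair_weight _ _ => E.
  transitivity (- p * t * (r * ((addable m j - t * q * addable m i)
                                * (addable m i - addable m j)))).
    by ring.
  by rewrite E; ring.
- have -> : (m i - m j = (m i - (m j).+1).+1)%N by lia.
  rewrite {2}/pair_weight big_nat_recr //= -/(pair_weight _ _).
  have e : t ^+ (j - i) * addable m i = q ^+ (m i - (m j).+1) * (q * addable m j).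
    apply: (mulIf (expf_neq0 (m j) q0)); rewrite dE.
    by rewrite -[in q ^+ m i](subnK lij) addnS exprS exprD; ring.
  have := pair_ratioE d0 (y0 i) (mulf_neq0 q0 (y0 j)) e.
  set r := pair_ratio _ _; set p := pair_weight _ _ => E.
  have {}E : r * ((addable m j - t * addable m i) * (addable m i - q * addable m j))
    = (addable m j - addable m i) * (addable m i - t * (q * addable m j)).
    apply: (mulfI q0).
    transitivity (r * ((q * addable m j - t * q * addable m i)
                       * (addable m i - q * addable m j))); first by ring.
    by rewrite E; ring.
  transitivity (- p * t * (r * ((addable m j - t * addable m i)
                                * (addable m i - q * addable m j)))).
    by rewrite E; ring.
  by ring.
- by ring.
Qed.

Lemma prod_pairs_const (a : 'I_N -> K) :
  \prod_(i < N) \prod_(j < N | (i < j)%N) a j = \prod_(j < N) a j ^+ j.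
Proof.
rewrite (exchange_big_dep predT) //=; apply: eq_bigr => j _.
by rewrite (big_ord_narrow (ltnW (ltn_ord j))) prodr_const card_ord.
Qed.

Lemma prod_pairs (a : 'I_N -> K) :
  \prod_(i < N) \prod_(j < N | (i < j)%N) (a i * a j) = \prod_(i < N) a i ^+ N.-1.
Proof.
under eq_bigr => i _ do rewrite big_split /=.
rewrite big_split /= prod_pairs_const -big_split /=.
apply: eq_bigr => i _.
have -> : \prod_(j < N | (i < j)%N) a i = \prod_(i.+1 <= j < N) a i.
  by rewrite big_geq_mkord.
rewrite prodr_const_nat -exprD.
by congr (_ ^+ _); have := ltn_ord i; lia.
Qed.

Lemma shape_weight_step (v : K) (l m : 'I_N -> nat) :
  (forall i, l i = m i + (i \in A))%N ->
  noninc m -> noninc l ->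
  shape_weight (q * v) l
    * (\prod_(i < N) if i \in A then 1 - t ^- N.-1 * addable l i else addable l i - q * v)
    * vandermonde (fun i => if i \in A then t * addable l i else addable l i)
    * vandermonde (addable m) * \prod_(j < N) t ^+ j
  = (\prod_(i < N) (t ^+ i - q * v)) * q ^+ (\sum_(i < N) m i) * (- t ^+ N.-1) ^+ #|A|
    * shape_weight v m
    * vandermonde (fun i => if i \in A then addable m i else t * addable m i)
    * vandermonde (addable l).
Proof.
move=> lm nm nl.
pose tau i := if i \in A then t else 1.
have -> : (- t ^+ N.-1) ^+ #|A| = (\prod_(i < N) if i \in A then -1 else 1)
                                  * \prod_(i < N) tau i ^+ N.-1.
  rewrite -[- t ^+ _]mulN1r -big_split /= -prodr_const big_mkcond /=.
  by apply: eq_bigr => i _; rewrite /tau; case: ifP => _; rewrite ?expr1n ?mulr1.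
rewrite -prod_pairs -prod_pairs_const /shape_weight.
have rows : \prod_(i < N) (row_weight (q * v) i (l i)
     * (if i \in A then 1 - t ^- N.-1 * addable l i else addable l i - q * v))
  = \prod_(i < N) ((t ^+ i - q * v) * q ^+ m i * (if i \in A then -1 else 1)
     * row_weight v i (m i)).
  by apply: eq_bigr => i _; exact: row_weight_step.
have pairs : \prod_(i < N) \prod_(j < N | (i < j)%N)
     (pair_weight (j - i) (l i - l j)
       * ((if j \in A then t * addable l j else addable l j)
          - (if i \in A then t * addable l i else addable l i))
       * (addable m j - addable m i) * t)
  = \prod_(i < N) \prod_(j < N | (i < j)%N)
     (pair_weight (j - i) (m i - m j) * (tau i * tau j)
       * ((if j \in A then addable m j else t * addable m j)
          - (if i \in A then addable m i else t * addable m i))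
       * (addable l j - addable l i)).
  by apply: eq_bigr => i _; apply: eq_bigr => j ij; exact: pair_weight_step.
have big2 (f g : 'I_N -> 'I_N -> K) :
  \prod_(i < N) \prod_(j < N | (i < j)%N) (f i j * g i j)
  = (\prod_(i < N) \prod_(j < N | (i < j)%N) f i j)
    * \prod_(i < N) \prod_(j < N | (i < j)%N) g i j.
  by rewrite -big_split; apply: eq_bigr => i _; rewrite big_split.
move: rows pairs; rewrite !big2 !big_split /= expr_sum => rows pairs.
rewrite /vandermonde.
have := congr2 *%R rows pairs.
set X1 := (X in X = _ -> _); set X2 := (X in _ = X -> _) => E.
transitivity X1; first by rewrite /X1; ring.
by rewrite E /X2; ring.
Qed.

End Generic.

(** * Sum over the partitions in a rectangle *)

Section Recursion.
Variables (K : fieldType) (t q : K).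
Hypothesis gen : generic t q.
Variable N : nat.

Lemma vandermonde_neq (x : 'I_N -> K) (i j : 'I_N) :
  vandermonde x != 0 -> (i < j)%N -> x j != x i.
Proof.
move=> /prodf_neq0/(_ i isT)/prodf_neq0/(_ j) H ij.
by rewrite -subr_eq0; apply: H.
Qed.

(** If two consecutive rows have the same length then x_(i+1) = t x_i, so the
    rescaled Vandermonde product vanishes as soon as row i is rescaled and
    row i + 1 is not.  This is how the subset sums select the sets A that are
    vertical strips. *)
Lemma scaled_chain (B : {set 'I_N}) (l : 'I_N -> nat) (i j : 'I_N) :
  noninc l ->
  vandermonde (fun i => if i \in B then t * addable t q l i else addable t q l i) != 0 ->
  i \in B -> (i <= j)%N -> l j = l i -> j \in B.
Proof.
move=> /nonincP nl V0 iB.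
have [n] := ubnP (j - i)%N; elim: n j => // n IH j.
rewrite ltnS => jn ij lji.
have [/val_inj <- //|ne] := eqVneq (val i) (val j).
have lt : (i < j)%N by move: ne; rewrite /=; lia.
have j'N : (j.-1 < N)%N by have := ltn_ord j; lia.
pose j' := Ordinal j'N.
have ij' : (i <= j')%N by rewrite /=; lia.
have j'j : (j' <= j)%N by rewrite /=; lia.
have lj' : l j' = l i by have := nl _ _ ij'; have := nl _ _ j'j; lia.
have j'B : j' \in B by apply: IH => //=; lia.
apply: contraT => jB.
have /(vandermonde_neq V0) : (j' < j)%N by rewrite /=; lia.
rewrite j'B (negbTE jB) /addable lj' lji.
have {1}-> : (j : nat) = j'.+1 by rewrite /=; lia.
by rewrite exprS mulrA eqxx.
Qed.

Definition add_strip M (A : {set 'I_N}) (l : {ffun 'I_N -> 'I_M.+1}) :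
  {ffun 'I_N -> 'I_M.+2} := [ffun i => inord (l i + (i \in A))].
Definition remove_strip M (A : {set 'I_N}) (l : {ffun 'I_N -> 'I_M.+2}) :
  {ffun 'I_N -> 'I_M.+1} := [ffun i => inord (l i - (i \in A))].

Lemma add_stripE M (A : {set 'I_N}) (l : {ffun 'I_N -> 'I_M.+1}) i :
  add_strip A l i = (l i + (i \in A))%N :> nat.
Proof. by rewrite ffunE inordK //; have := ltn_ord (l i); case: (_ \in _); lia. Qed.

Lemma add_stripK M (A : {set 'I_N}) (l : {ffun 'I_N -> 'I_M.+1}) :
  remove_strip A (add_strip A l) = l.
Proof.
apply/ffunP => i; apply: val_inj.
by rewrite ffunE add_stripE addnK /= inordK.
Qed.

Definition nonincf M (l : {ffun 'I_N -> 'I_M.+1}) : bool := noninc (fun i => l i : nat).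

(** Terms of [strip_removal_sum] for which A is not a removable strip vanish:
    [scaled_chain] handles rows of equal length, the last factor 1 - t^-(N-1) x
    forbids removing a box from an empty row, and the factor x_0 - q^(M+1) forces
    a first row of length M + 1 to lose a box, hence all rows of this length. *)
Lemma strip_removable M (A : {set 'I_N}) (l : {ffun 'I_N -> 'I_M.+2}) :
  nonincf l ->
  (\prod_(i < N) if i \in A then 1 - t ^- N.-1 * addable t q (fun i => l i) i
                 else addable t q (fun i => l i) i - q * q ^+ M)
    * vandermonde (fun i => if i \in A then t * addable t q (fun i => l i) i
                            else addable t q (fun i => l i) i) != 0 ->
  (add_strip A (remove_strip A l) == l) && nonincf (remove_strip A l).
Proof.
move=> nl; rewrite mulf_eq0 negb_or => /andP[/prodf_neq0 P0 V0].
have chain i j := @scaled_chain A (fun i => l i) i j nl V0.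
have {}nl := nonincP _ nl; rewrite /= in nl.
have pos i : i \in A -> (0 < l i)%N.
  move=> iA; rewrite lt0n; apply/eqP => li.
  have nN : (N.-1 < N)%N by have := ltn_ord i; lia.
  pose n := Ordinal nN.
  have i_n : (i <= n)%N by have := ltn_ord i; rewrite /=; lia.
  have ln : l n = l i :> nat by have := nl _ _ i_n; lia.
  have := P0 n isT; rewrite (chain i n) // /addable ln li expr0 mulr1 /=.
  by rewrite mulVf ?subrr ?eqxx // expf_neq0 // (generic_t_neq0 gen).
have top i : (l i = M.+1 :> nat) -> i \in A.
  move=> li.
  have N0 : (0 < N)%N by have := ltn_ord i; lia.
  pose o := Ordinal N0.
  have lo : l o = M.+1 :> nat by have := nl o i (leq0n _); have := ltn_ord (l o); lia.
  apply: (chain o) => //; last by rewrite lo.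
  apply: contraT => oA; have := P0 o isT.
  by rewrite (negbTE oA) /addable lo expr0 mul1r -exprS subrr eqxx.
have rE i : remove_strip A l i = (l i - (i \in A))%N :> nat.
  rewrite ffunE inordK //.
  have := ltn_ord (l i); have := pos i; have := top i.
  case: (i \in A) => /= li _ ltl; first by lia.
  by have [/li //|ne] := eqVneq (l i : nat) M.+1; lia.
apply/andP; split.
  apply/eqP/ffunP => i; apply: val_inj; rewrite /= add_stripE rE.
  by have := pos i; case: (i \in A) => /=; lia.
apply/nonincP => i j ij; rewrite !rE.
have := nl _ _ ij; have := chain i j; have := pos i.
by case: (i \in A); case: (j \in A) => //=; lia.
Qed.

(** Here the complement of A is rescaled, so [scaled_chain] applies to it: a
    nonzero term forces the rows above a row of A of the same length into A. *)
Lemma strip_addable M (A : {set 'I_N}) (m : {ffun 'I_N -> 'I_M.+1}) :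
  nonincf m ->
  vandermonde (fun i => if i \in A then addable t q (fun i => m i) i
                        else t * addable t q (fun i => m i) i) != 0 ->
  nonincf (add_strip A m).
Proof.
move=> nm V0.
have chain (i j : 'I_N) : i \notin A -> (i <= j)%N -> m j = m i :> nat -> j \notin A.
  have := @scaled_chain (~: A) (fun i => m i) i j nm; rewrite !inE; apply.
  apply: contra V0 => /eqP <-; apply/eqP.
  by apply: eq_bigr => a _; apply: eq_bigr => b _; rewrite !inE; do 2 case: (_ \in A).
have {}nm := nonincP _ nm; rewrite /= in nm.
apply/nonincP => i j ij; rewrite !add_stripE.
have := nm _ _ ij; have := chain i j.
by case: (i \in A); case: (j \in A) => //=; lia.
Qed.

Definition box_sum M (z : K) : K :=
  \sum_(l : {ffun 'I_N -> 'I_M.+1} | nonincf l)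
    z ^+ (\sum_(i < N) l i)%N * shape_weight t q (q ^+ M) (fun i => l i).

Lemma box_sum0 z : box_sum 0 z = 1.
Proof.
rewrite /box_sum (big_pred1 [ffun=> ord0]); last first.
  move=> l; rewrite /=; have -> : l = [ffun=> ord0] by apply/ffunP => i; rewrite ffunE ord1.
  by rewrite eqxx; apply/nonincP => i j _; rewrite !ffunE.
rewrite big1 ?expr0 ?mul1r => [|i _]; last by rewrite ffunE.
rewrite /shape_weight !big1 ?mulr1 // => i _; last by rewrite /row_weight ffunE big_geq.
by apply: big1 => j _; rewrite /pair_weight !ffunE big_geq.
Qed.

(** Insert 1 in the form of [strip_removal_sum] into the sum over l, exchange the
    two sums, substitute l = m + A with [shape_weight_step], and evaluate the
    sum over A with [strip_addition_sum]. *)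
Lemma box_sumS M z :
  box_sum M.+1 z = box_sum M (q * z) * \prod_(m < N) (1 - z * t ^+ m).
Proof.
set v := q ^+ M.
pose W : K := \prod_(i < N) (t ^+ i - q * v).
have t0 := generic_t_neq0 gen.
have W0 : W != 0.
  apply/prodf_neq0 => i _; rewrite -exprS -[t ^+ i]mulr1 -[q ^+ _]mul1r.
  by apply: (@generic_neq _ _ _ gen i 0 0 M.+1); apply/eqP => -[].
pose B : K := \prod_(j < N) t ^+ j.
have B0 : B != 0 by apply/prodf_neq0 => i _; rewrite expf_neq0.
have ct : t ^- N.-1 * t ^+ N.-1 = 1 by rewrite mulVf // expf_neq0.
pose T (A : {set 'I_N}) (l : 'I_N -> nat) :=
  (\prod_(i < N) if i \in A then 1 - t ^- N.-1 * addable t q l i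
                 else addable t q l i - q * v)
  * vandermonde (fun i => if i \in A then t * addable t q l i else addable t q l i).
pose Y (A : {set 'I_N}) (m : 'I_N -> nat) :=
  vandermonde (fun i => if i \in A then addable t q m i else t * addable t q m i).
(* [W] is the sum over A of the quotients of [T A l] by the Vandermonde product. *)
apply: (mulIf W0).
transitivity (\sum_(A : {set 'I_N}) \sum_(l : {ffun 'I_N -> 'I_M.+2} | nonincf l)
   z ^+ (\sum_(i < N) l i)%N * shape_weight t q (q * v) (fun i => l i)
     * (T A (fun i => l i) / vandermonde (addable t q (fun i => l i)))).
  rewrite exchange_big /= mulr_suml; apply: eq_bigr => l nl.
  rewrite -mulr_sumr -mulr_suml (strip_removal_sum _ _ ct) -/W.
  have := vandermonde_addable_neq0 gen nl; set V := vandermonde _ => V0.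
  by rewrite [V * W]mulrC mulfK // /v -exprS.
transitivity (\sum_(A : {set 'I_N}) \sum_(m : {ffun 'I_N -> 'I_M.+1} | nonincf m)
   (q * z) ^+ (\sum_(i < N) m i)%N * shape_weight t q v (fun i => m i) * (W / B)
     * (- z * t ^+ N.-1) ^+ #|A|
     * (Y A (fun i => m i) / vandermonde (addable t q (fun i => m i)))).
  apply: eq_bigr => A _.
  rewrite (bigID (fun l => (add_strip A (remove_strip A l) == l)
                     && nonincf (remove_strip A l))) /= [X in _ + X]big1 ?addr0; last first.
    move=> l /andP[nl]; apply: contraNeq => nz; apply: strip_removable => //.
    by apply: contraNneq nz; rewrite -/(T A _) => ->; rewrite mul0r mulr0.
  rewrite [RHS](bigID (fun m => nonincf (add_strip A m))) /= [X in _ = _ + X]big1 ?addr0;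
    last first.
    move=> m /andP[nm]; apply: contraNeq => nz; apply: strip_addable => //.
    by apply: contraNneq nz; rewrite -/(Y A _) => ->; rewrite mul0r mulr0.
  rewrite (reindex_onto (@add_strip M A) (@remove_strip M A)) /=; last first.
    by move=> l /and3P[_ /eqP].
  apply: eq_big => [m | m /andP[/andP[nl hm] _]]; last move: hm.
    by rewrite add_stripK !eqxx andbT andTb andbC.
  move=> hm; have nm : nonincf m by move: hm; rewrite add_stripK => /andP[].
  have := shape_weight_step gen v (add_stripE A m) nm nl.
  rewrite -/B -/W -/(Y A _).
  have := vandermonde_addable_neq0 gen nl; set Vx := vandermonde (addable _ _ _) => Vx0.
  have := vandermonde_addable_neq0 gen nm; set Vy := vandermonde (addable _ _ _) => Vy0 step.
  have -> : (\sum_(i < N) add_strip A m i = \sum_(i < N) m i + #|A|)%N.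
    rewrite -sum1_card [X in (_ + X)%N]big_mkcond -big_split /=.
    by apply: eq_bigr => i _; rewrite add_stripE; case: (i \in A).
  rewrite exprD mulNr -mulrN !exprMn.
  apply: (mulIf (mulf_neq0 (mulf_neq0 Vx0 Vy0) B0)).
  set n := (\sum_(i < N) m i)%N in step *.
  move: step; rewrite /T.
  set P := \prod_(i < N) _; set X := vandermonde _.
  set S := shape_weight _ _ _ _; set S' := shape_weight _ _ _ _.
  set a := (- _) ^+ _ => step.
  transitivity (z ^+ n * z ^+ #|A| * (S * P * X * Vy * B)).
    by field.
  by rewrite step; field; rewrite Vy0.
rewrite exchange_big /= /box_sum mulr_suml mulr_suml; apply: eq_bigr => m nm.
have := vandermonde_addable_neq0 gen nm; set V := vandermonde _ => V0.
under eq_bigr => A _ do rewrite -mulrA [_ ^+ #|_| * _]mulrA.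
rewrite -mulr_sumr -mulr_suml strip_addition_sum -/V.
have -> : \prod_(m < N) (t ^+ m + - z * t ^+ N.-1) = B * \prod_(m < N) (1 - z * t ^+ m).
  (* The factor t ^+ i pairs with 1 - z t ^+ (N - 1 - i). *)
  rewrite [X in _ = _ * X](reindex_inj rev_ord_inj) -big_split /=.
  apply: eq_bigr => i _; have -> : N.-1 = (i + (N - i.+1))%N by have := ltn_ord i; lia.
  by rewrite exprD; ring.
set D := \prod_(m < N) (1 - _).
set S := shape_weight _ _ _ _; set x := _ ^+ (\sum_(i < N) m i)%N.
by field; rewrite V0 B0.
Qed.

Lemma box_sumE M z :
  box_sum M z = \prod_(b < M) \prod_(a < N) (1 - z * q ^+ b * t ^+ a).
Proof.
elim: M z => [|M IH] z; first by rewrite box_sum0 big_ord0.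
rewrite box_sumS IH big_ord_recl mulrC; congr (_ * _).
  by apply: eq_bigr => a _; rewrite expr0 mulr1.
apply: eq_bigr => b _; apply: eq_bigr => a _.
by rewrite exprS; congr (1 - _ * _); ring.
Qed.

End Recursion.

(** * Exterior powers, symmetric powers and boxes *)

Section Characters.
Variables (K : fieldType) (t1 t2 : K).

Lemma LambdaE m (V : seq weight) :
  Lambda t1 t2 m V = \prod_(w <- V) (1 - m * ev t1 t2 w).
Proof.
rewrite (big_nth (0, 0)) big_mkord.
under [RHS]eq_bigr => j _ do rewrite addrC -mulNr.
rewrite bigA_distr /Lambda.
rewrite [RHS](partition_big
  (fun A : {set 'I_(size V)} => inord #|A| : 'I_(size V).+1) predT) //=.
apply: eq_bigr => i _; rewrite /ext_pow mulr_sumr; apply: eq_big => A.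
  rewrite -val_eqE /= inordK // ltnS.
  by have := max_card (mem A); rewrite card_ord.
move=> /eqP <-; rewrite -prodr_const -big_split big_mkcond /=.
by apply: eq_bigr => j _; case: ifP.
Qed.

Lemma ext_pow0 (V : seq weight) : ext_pow t1 t2 0 V = 1.
Proof.
rewrite /ext_pow (big_pred1 set0) ?big_set0 // => A.
by rewrite /= cards_eq0.
Qed.

Lemma ext_pow_top (V : seq weight) :
  ext_pow t1 t2 (size V) V = \prod_(w <- V) ev t1 t2 w.
Proof.
rewrite (big_nth (0, 0)) big_mkord /ext_pow (big_pred1 setT) => [|A].
  by apply: eq_bigl => j; rewrite inE.
rewrite /= eqEcard subsetT cardsT card_ord /= eqn_leq.
by have := max_card (mem A); rewrite card_ord => ->.
Qed.

Lemma sym_pow0 (V : seq weight) : sym_pow t1 t2 0 V = 1.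
Proof.
rewrite /sym_pow (big_pred1 [ffun=> ord0]) => [|e].
  by rewrite big1 // => j _; rewrite ffunE expr0.
have -> : e = [ffun=> ord0] by apply/ffunP => i; rewrite ffunE ord1.
rewrite /= eqxx; apply/eqP; rewrite big1 // => i _; by rewrite ffunE.
Qed.

(** At y = 0 the third exterior factor and the symmetric factor reduce to
    their terms of degree 0. *)
Lemma integrand_y0 m1 m2 m3 n l :
  integrand t1 t2 m1 m2 m3 n l 0 =
  Lambda t1 t2 m1 (dual (taut l)) * Lambda t1 t2 m2 (dual (taut l))
    * ext_pow t1 t2 n (taut l).
Proof.
rewrite /integrand /fps_mul big_ord_recl big_ord0 addr0 /Lambda_y /Sym_y.
by rewrite expr0 ext_pow0 sym_pow0 !mulr1.
Qed.

Lemma big_boxes (l : seq nat) (F : nat * nat -> K) N : (size l <= N)%N ->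
  \prod_(b <- boxes l) F b =
  \prod_(0 <= i < N) \prod_(0 <= c < nth 0%N l i) F (i, c).
Proof.
move=> lN; rewrite /boxes big_allpairs_dep (@big_cat_nat _ _ _ (size l)) //=.
rewrite [X in _ = _ * X]big_nat_cond [X in _ = _ * X]big1 ?mulr1; last first.
  by move=> i /andP[/andP[li _] _]; rewrite nth_default // big_geq.
rewrite /index_iota subn0; apply: eq_bigr => i _; by rewrite subn0.
Qed.

End Characters.

Lemma size_boxes l : size (boxes l) = sumn l.
Proof.
rewrite /boxes size_allpairs_dep; congr sumn.
apply: (@eq_from_nth _ 0%N); rewrite ?size_map ?size_iota // => i il.
by rewrite (nth_map 0%N) ?size_iota // nth_iota // size_iota.
Qed.

Lemma partition_noninc l : is_partition l ->
  forall i j, (i <= j)%N -> (nth 0 l j <= nth 0 l i)%N.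
Proof.
move=> /andP[sl _] i j ij.
have [lj|jl] := leqP (size l) j; first by rewrite nth_default.
by apply: (sorted_leq_nth (leT := geq)) => //; rewrite ?inE //;
  [move=> a b c /=; lia | move=> a /= | lia].
Qed.

(** The columns c with l_(k+1) <= c < l_k are those with exactly k + 1 boxes. *)
Lemma nth_conj_partition l k c : is_partition l ->
  (nth 0 l k.+1 <= c < nth 0 l k)%N -> nth 0%N (conj_partition l) c = k.+1.
Proof.
move=> pl /andP[kc ck]; have ni := partition_noninc pl.
have ch : (c < head 0 l)%N by rewrite -nth0; have := ni 0%N k isT; lia.
rewrite /conj_partition nth_mkseq // -sum1_count (big_nth 0%N).
have kl : (k < size l)%N.
  by rewrite ltnNge; apply/negP => lk; move: ck; rewrite nth_default.
rewrite (@big_cat_nat _ _ _ k.+1) //=.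
rewrite [X in (_ + X)%N]big_nat_cond [X in (_ + X)%N]big1 ?addn0; last first.
  by move=> i /andP[/andP[ki _]]; have := ni _ _ ki; lia.
rewrite big_nat_cond (eq_bigl (fun i => (0 <= i < k.+1)%N && true)); last first.
  move=> i /=; case: ltnP => //= ik.
  by have := ni i k; lia.
by rewrite -big_nat_cond sum_nat_const_nat; lia.
Qed.

(** * Hooks along a row *)

Section Rows.
Variables (K : fieldType) (lam : nat -> nat).
Hypothesis lamP : forall i j, (i <= j)%N -> (lam j <= lam i)%N.

Lemma prod_row_split (f : nat -> nat -> K) (L : nat -> nat) i D :
  (forall d c, (lam (i + d.+1) <= c < lam (i + d))%N -> L c = d) ->
  \prod_(lam (i + D) <= c < lam i) f (L c) c
  = \prod_(0 <= d < D) \prod_(lam (i + d.+1) <= c < lam (i + d)) f d c.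
Proof.
move=> HL; elim: D => [|D IH]; first by rewrite addn0 !big_geq.
rewrite big_nat_recr //= -IH (@big_cat_nat _ _ _ (lam (i + D))) /=; last 2 first.
- by apply: lamP; lia.
- by apply: lamP; lia.
rewrite mulrC; congr (_ * _).
by rewrite big_nat_cond [RHS]big_nat_cond; apply: eq_bigr => c /andP[/HL -> _].
Qed.

Lemma prod_rev_segment (g : nat -> K) p m n : (p <= m <= n)%N ->
  \prod_(p <= c < m) g (n - c - 1)%N * \prod_(0 <= a < n - m) g a
  = \prod_(0 <= a < n - p) g a.
Proof.
move=> /andP[]; elim: m => [|m IH] pm mn.
  by move: pm; rewrite leqn0 => /eqP ->; rewrite big_geq // mul1r.
move: pm; rewrite leq_eqVlt => /predU1P[->|]; first by rewrite big_geq // mul1r.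
rewrite ltnS => pm; rewrite -IH ?(ltnW mn) // big_nat_recr //= -mulrA; congr (_ * _).
have -> : (n - m = (n - m.+1).+1)%N by lia.
by rewrite big_nat_recr //= mulrC; congr (_ * g _); lia.
Qed.

(** The boxes of row [i] with leg [d] fill the columns from lam (i+d+1) to
    lam (i+d), and their arms form an interval, so their product is a quotient of
    two initial products of [phi _ d].  Regrouping these quotients by the row
    i + d + 1 leaves one factor for each lower row and, since row i + e + 1 is
    empty, one product with the maximal leg [e]. *)
Lemma prod_row_hooks (phi : nat -> nat -> K) (L : nat -> nat) i e :
  (forall a l, phi a l != 0) -> lam (i + e.+1) = 0%N ->
  (forall d c, (lam (i + d.+1) <= c < lam (i + d))%N -> L c = d) ->
  \prod_(0 <= c < lam i) phi (lam i - c - 1)%N (L c)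
    * \prod_(0 <= d < e) \prod_(0 <= a < lam i - lam (i + d.+1)) (phi a d.+1 / phi a d)
  = \prod_(0 <= a < lam i) phi a e.
Proof.
move=> phi0 lam0 HL.
pose P d k := \prod_(0 <= a < k) phi a d.
have P0 d k : P d k != 0.
  by apply: (big_ind (fun x => x != 0)) => //; [exact: oner_neq0 | exact: mulf_neq0].
have := prod_row_split (fun d c => phi (lam i - c - 1)%N d) e.+1 HL.
rewrite lam0 => ->.
have -> : \prod_(0 <= d < e) \prod_(0 <= a < lam i - lam (i + d.+1)) (phi a d.+1 / phi a d)
  = \prod_(0 <= d < e) (P d.+1 (lam i - lam (i + d.+1)) / P d (lam i - lam (i + d.+1)))%N.
  by apply: eq_bigr => d _; rewrite big_split /= prodfV.
have seg d : \prod_(lam (i + d.+1) <= c < lam (i + d)) phi (lam i - c - 1)%N d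
  = P d (lam i - lam (i + d.+1))%N / P d (lam i - lam (i + d))%N.
  apply: (mulIf (P0 d (lam i - lam (i + d))%N)); rewrite divfK //.
  by apply: (@prod_rev_segment (fun a => phi a d)); rewrite !lamP //; lia.
under eq_bigr => d _ do rewrite seg.
have -> : \prod_(0 <= a < lam i) phi a e = P e (lam i - lam (i + e.+1))%N.
  by rewrite lam0 subn0.
elim: e {lam0} => [|e IH].
  by rewrite big_nat1 big_geq // mulr1 addn0 subnn {2}/P big_geq // divr1.
rewrite [X in X * _]big_nat_recr // [X in _ * X]big_nat_recr //= mulrACA IH.
by field; rewrite !P0.
Qed.
End Rows.

(** * Contribution of a fixed point *)

Section FixedPoint.
Variables (K : fieldType) (t q : K).
Hypothesis gen : generic t q.

Lemma ev_inv_taut (a b : nat) : ev t^-1 q^-1 (- - (a%:Z), - - (b%:Z)) = (t ^+ a * q ^+ b)^-1.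
Proof. by rewrite /ev !opprK /= -!exprnP !exprVn invfM. Qed.

Lemma ev_taut (a b : nat) : ev t^-1 q^-1 (- (a%:Z), - (b%:Z)) = t ^+ a * q ^+ b.
Proof. by rewrite /ev /= !exprz_inv !opprK -!exprnP. Qed.

Lemma tangent_euler_class l :
  \prod_(w <- dual (tangent l)) (1 - ev t^-1 q^-1 w)
  = \prod_(b <- boxes l) hook_factor t q (arm l b) (leg l b).
Proof.
rewrite /dual /tangent map_cat big_cat !big_map /hook_factor big_split /=.
congr (_ * _); apply: eq_bigr => b _; rewrite /ev /=;
  rewrite !opprK !exprz_inv ?opprK -!PoszD !addn1 -?exprnP -?exprnN //.
Qed.

(** The sign (-1)^|l|, the determinant of the tautological bundle and the factors
    with m1 = t^N combine with the product of maximal-leg hook factors from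
    [prod_row_hooks] into the row factors. *)
Lemma fixed_point_contribution N l v : is_partition l -> (size l <= N)%N ->
  (-1) ^+ sumn l * (Lambda t^-1 q^-1 (t ^+ N) (dual (taut l))
    * Lambda t^-1 q^-1 v (dual (taut l)) * ext_pow t^-1 q^-1 (sumn l) (taut l))
    / \prod_(w <- dual (tangent l)) (1 - ev t^-1 q^-1 w)
  = shape_weight t q v (fun i : 'I_N => nth 0%N l i).
Proof.
move=> pl lN; have ni := partition_noninc pl.
have t0 := generic_t_neq0 gen; have q0 := generic_q_neq0 gen.
rewrite tangent_euler_class !LambdaE.
have sz : size (taut l) = sumn l by rewrite /taut size_map size_boxes.
have -> : (-1) ^+ sumn l = \prod_(b <- boxes l) (-1 : K).
  by rewrite big_const_seq count_predT size_boxes -Monoid.iteropE.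
rewrite -sz ext_pow_top /taut /dual !big_map.
rewrite -prodfV -!big_split /=.
rewrite (big_boxes _ lN) big_mkord /shape_weight -big_split /=.
apply: eq_bigr => i _.
have iN := ltn_ord i.
pose e := (N - i).-1.
have -> : \prod_(j < N | (i < j)%N) pair_weight t q (j - i) (nth 0 l i - nth 0 l j)
   = \prod_(0 <= d < e) pair_weight t q d.+1 (nth 0 l i - nth 0 l (i + d.+1)).
  have -> : \prod_(j < N | (i < j)%N) pair_weight t q (j - i) (nth 0 l i - nth 0 l j)
     = \prod_(i.+1 <= j < N) pair_weight t q (j - i) (nth 0 l i - nth 0 l j).
    by rewrite big_geq_mkord.
  have -> : e = (N - i.+1)%N by rewrite /e; lia.
  rewrite -{1}[i.+1]add0n big_addn; apply: eq_bigr => d _.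
  have -> : (d + i.+1 = i + d.+1)%N by lia.
  by rewrite addKn.
have last0 : nth 0%N l (i + e.+1) = 0%N by rewrite nth_default // /e; lia.
have legE d c : (nth 0 l (i + d.+1) <= c < nth 0 l (i + d))%N -> leg l (nat_of_ord i, c) = d.
  move=> dc; rewrite /leg (@nth_conj_partition l (i + d) c) //=; first by lia.
  by rewrite -addnS.
have := prod_row_hooks ni (hook_factor_neq0 gen) last0 legE.
set H := \prod_(0 <= c < _) _; set P := \prod_(0 <= d < e) _ => HP.
have H0 : H != 0.
  by rewrite /H prodf_seq_neq0; apply/allP => c _; apply: hook_factor_neq0.
rewrite big_split prodfV /= -/H; apply: (canLR (mulfK H0)).
rewrite -mulrA [_ * H]mulrC HP -big_split /=.
apply: eq_bigr => c _; rewrite ev_inv_taut ev_taut /row_factor /hook_factor -/e.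
set D := 1 - t ^- e * _.
have D0 : D != 0.
  apply: contraNneq (hook_factor_neq0 gen c e).
  by rewrite /hook_factor -/D => ->; rewrite mul0r.
have -> : t ^+ N = t ^+ i * t ^+ e.+1 by rewrite -exprD; congr (_ ^+ _); rewrite /e; lia.
have ti0 : t ^+ i != 0 by rewrite expf_neq0.
have qc0 : q ^+ c != 0 by rewrite expf_neq0.
by field; rewrite D0 ti0 qc0.
Qed.
End FixedPoint.

(** * Partitions of n as bounded sequences and as row lengths *)

Lemma partition_eq l l' : is_partition l -> is_partition l' ->
  (forall i, nth 0%N l i = nth 0%N l' i) -> l = l'.
Proof.
move=> /andP[_ zl] /andP[_ zl'] e.
have le s s' : (0%N \notin s) -> (forall i, nth 0%N s i = nth 0%N s' i) ->
    (size s <= size s')%N.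
  move=> zs es; rewrite leqNgt; apply: contra zs => lt.
  by have := mem_nth 0%N lt; rewrite es nth_default.
apply: (@eq_from_nth _ 0%N) => [|i _]; last exact: e.
by apply/eqP; rewrite eqn_leq !le.
Qed.

(** The zeros of a nonincreasing sequence are at its end, where the default value
    of [nth] replaces them. *)
Lemma filter_pos_sorted s : sorted geq s ->
  sorted geq (filter (leq 1) s) /\ forall i, nth 0%N (filter (leq 1) s) i = nth 0%N s i.
Proof.
have tr : transitive geq by move=> a b c /=; lia.
move=> ss; split; first exact: sorted_filter.
elim: s ss => [|x s IH] //= xs i.
have ss := path_sorted xs.
case: x xs => [|x] xs /=; last by case: i => [|i] //=; apply: IH.
have z : all (pred1 0%N) s.
  by have := order_path_min tr xs; apply: sub_all => y /=; rewrite leqn0.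
have -> : filter (leq 1) s = [::].
  apply/eqP; rewrite -[_ == _]negbK -has_filter; apply/hasPn => y ys /=.
  by move/allP: z => /(_ y ys) /eqP ->.
rewrite nth_nil; case: i => //= i.
have [lt|ge] := ltnP i (size s); last by rewrite nth_default.
by move/allP: z => /(_ _ (mem_nth 0%N lt)) /eqP ->.
Qed.

Lemma sumn_nth l N : (size l <= N)%N -> (\sum_(i < N) nth 0 l i = sumn l)%N.
Proof.
move=> lN; rewrite sumnE (big_nth 0%N) -(big_mkord predT) (@big_cat_nat _ _ _ (size l)) //=.
rewrite [X in (_ + X)%N]big_nat_cond [X in (_ + X)%N]big1 ?addn0 // => i.
by move=> /andP[/andP[li _] _]; rewrite nth_default.
Qed.

Lemma mem_leq_sumn s x : x \in s -> (x <= sumn s)%N.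
Proof.
elim: s => //= y s IH; rewrite inE => /predU1P[->|/IH]; lia.
Qed.

Lemma size_leq_sumn s : 0%N \notin s -> (size s <= sumn s)%N.
Proof. by elim: s => //= y s IH; rewrite inE negb_or => /andP[y0 /IH]; lia. Qed.

Section Reindex.
Variables (N M n : nat).
Hypotheses (nN : (n <= N)%N) (nM : (n <= M)%N).

(** The index set of the localization formula: partitions of n encoded with at
    most n parts, each at most n. *)
Definition fits (l : {bseq n of 'I_n.+1}) : bool :=
  is_partition (map val l) && (sumn (map val l) == n).
Definition profile (g : {ffun 'I_N -> 'I_M.+1}) : bool :=
  nonincf g && ((\sum_(i < N) g i)%N == n).

Definition rows_of (l : {bseq n of 'I_n.+1}) : {ffun 'I_N -> 'I_M.+1} :=
  [ffun i : 'I_N => inord (nth 0%N (map val l) i)].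
Definition parts_of (g : {ffun 'I_N -> 'I_M.+1}) : {bseq n of 'I_n.+1} :=
  insub_bseq n [seq inord k | k <- filter (leq 1) [seq val (g i) | i <- enum 'I_N]].

Lemma size_bseq_parts (l : {bseq n of 'I_n.+1}) : (size (map val l) <= N)%N.
Proof. by rewrite size_map (leq_trans (size_bseq l)). Qed.

Lemma rows_ofE l (i : 'I_N) : fits l -> rows_of l i = nth 0%N (map val l) i :> nat.
Proof.
move=> /andP[_ /eqP sl]; rewrite ffunE inordK // ltnS (leq_trans _ nM) //.
have [lt|ge] := ltnP i (size (map val l)); last by rewrite nth_default.
by have := mem_leq_sumn (mem_nth 0%N lt); rewrite sl.
Qed.

Lemma rows_of_profile l : fits l -> profile (rows_of l).
Proof.
move=> fl; have /andP[pl /eqP sl] := fl.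
apply/andP; split; first by apply/nonincP => i j ij; rewrite !rows_ofE // partition_noninc.
under eq_bigr => i _ do rewrite rows_ofE //.
by rewrite sumn_nth ?sl // size_bseq_parts.
Qed.

Lemma parts_of_fits g : profile g -> fits (parts_of g) /\ rows_of (parts_of g) = g.
Proof.
move=> /andP[/nonincP ng /eqP sg].
set s0 := [seq val (g i) | i <- enum 'I_N].
have s0E (i : 'I_N) : nth 0%N s0 i = g i.
  by rewrite (nth_map i) ?size_enum_ord // nth_ord_enum.
have sz0 : size s0 = N by rewrite size_map size_enum_ord.
have srt : sorted geq s0.
  apply/(sortedP 0%N) => i; rewrite sz0 => lt.
  by rewrite (s0E (Ordinal lt)) (s0E (Ordinal (ltnW lt))); apply: ng => /=.
have [ss sE] := filter_pos_sorted srt.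
set s := filter _ _ in ss sE.
have z : 0%N \notin s by rewrite mem_filter.
have sumE : sumn s = n.
  rewrite -(@sumn_nth s N); last by rewrite -sz0 size_filter count_size.
  by rewrite -[RHS]sg; apply: eq_bigr => i _; rewrite sE s0E.
have pE : map val (parts_of g) = s.
  rewrite /parts_of -/s0 -/s insubdK; last first.
    by rewrite unfold_in size_map -[X in (_ <= X)%N]sumE size_leq_sumn.
  rewrite -map_comp -[RHS]map_id; apply/eq_in_map => k ks /=.
  by rewrite inordK // ltnS -[X in (_ <= X)%N]sumE mem_leq_sumn.
have fg : fits (parts_of g) by rewrite /fits pE /is_partition ss z sumE eqxx.
split=> //; apply/ffunP => i; apply: val_inj.
by rewrite /= rows_ofE // pE sE s0E.
Qed.

Lemma rows_ofK l : fits l -> parts_of (rows_of l) = l.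
Proof.
move=> fl; have [fl' e] := parts_of_fits (rows_of_profile fl).
apply/val_inj/(inj_map val_inj); have /andP[p _] := fl; have /andP[p' _] := fl'.
apply: partition_eq => // i.
have [lt|ge] := ltnP i N; last first.
  by rewrite !nth_default // (leq_trans (size_bseq_parts _)).
by rewrite -(rows_ofE (Ordinal lt) fl) -(rows_ofE (Ordinal lt) fl') e.
Qed.

(** As N, M >= n, listing row lengths, padded by zeros, identifies the partitions
    of n with those in the N x M rectangle. *)
Lemma fits_reindex (K : fieldType) (G : {ffun 'I_N -> 'I_M.+1} -> K) :
  \sum_(g | profile g) G g = \sum_(l | fits l) G (rows_of l).
Proof.
rewrite (reindex_onto rows_of parts_of) => [|g /parts_of_fits[] //].
apply: eq_bigl => l; apply/andP/idP => [[pl /eqP <-] | fl].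
  by have [] := parts_of_fits pl.
by rewrite rows_of_profile // rows_ofK.
Qed.

End Reindex.

(** * Exponential of a power-sum series *)

Section Exp.
Variable K : fieldType.
Hypothesis char0 : forall n, n.+1%:R != 0 :> K.

Lemma fact_neq0 n : n`!%:R != 0 :> K.
Proof. by have := char0 n`!.-1; rewrite prednK // fact_gt0. Qed.

Lemma fps_exp_nat_poly (f : fps K) m k n : (n < m)%N ->
  ((\poly_(i < m) f i) ^+ k)`_n = fps_exp_nat f k n.
Proof.
elim: k n => [|k IH] n nm; first by rewrite expr0 coef1 /= /fps_one.
rewrite exprS coefM /fps_exp_nat iterS -/(fps_exp_nat f k) /fps_mul.
apply: eq_bigr => i _; rewrite coef_poly IH; last by have := ltn_ord i; lia.
by have -> : (i < m)%N by have := ltn_ord i; lia.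
Qed.

Lemma coef_exp_low (p : {poly K}) k n : p`_0 = 0 -> (n < k)%N -> (p ^+ k)`_n = 0.
Proof.
move=> p0; elim: k n => // k IH n nk; rewrite exprS coefM big1 // => i _.
have [i0|i0] := posnP i; first by rewrite i0 p0 mul0r.
by rewrite IH ?mulr0 //; have := ltn_ord i; lia.
Qed.

(** Truncated exponential, so that the derivation of polynomials can be used in
    place of one on power series. *)
Definition exp_poly M (p : {poly K}) : {poly K} := \sum_(k < M) k`!%:R^-1 *: p ^+ k.

Lemma coef_exp_poly (f : fps K) m M n : f 0%N = 0 -> (n < m)%N -> (n < M)%N ->
  (exp_poly M (\poly_(i < m) f i))`_n = fps_exp f n.
Proof.
move=> f0 nm nM; set p := \poly_(i < m) f i; rewrite /exp_poly coef_sum /fps_exp.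
rewrite -[in RHS](big_mkord predT (fun k => fps_exp_nat f k n / k`!%:R)).
rewrite -(big_mkord predT (fun k => (k`!%:R^-1 *: p ^+ k : {poly K})`_n)).
rewrite (@big_cat_nat _ _ _ n.+1) //= [X in _ + X]big_nat_cond [X in _ + X]big1 ?addr0.
  by apply: eq_bigr => k _; rewrite coefZ fps_exp_nat_poly // mulrC.
move=> k /andP[/andP[nk _] _]; rewrite coefZ coef_exp_low ?mulr0 //.
by rewrite coef_poly; case: ifP.
Qed.

Lemma deriv_exp_poly M (p : {poly K}) : (exp_poly M.+1 p)^`() = p^`() * exp_poly M p.
Proof.
rewrite /exp_poly big_ord_recl /= expr0 derivD derivZ -[X in X^`()]polyC1.
rewrite derivC scaler0 add0r.
rewrite raddf_sum mulr_sumr; apply: eq_bigr => k _.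
rewrite /= derivZ deriv_exp /bump add1n /= -scaler_nat scalerA -scalerAr; congr (_ *: _).
by rewrite factS natrM; field; rewrite fact_neq0 nat1r char0.
Qed.

(** The coefficients of E' = f' E for E = exp f; with E_0 = 1 they determine E. *)
Lemma fps_exp_rec (f : fps K) n : f 0%N = 0 ->
  n.+1%:R * fps_exp f n.+1 = \sum_(i < n.+1) i.+1%:R * f i.+1 * fps_exp f (n - i)%N.
Proof.
move=> f0; have := congr1 (fun p : {poly K} => p`_n)
  (deriv_exp_poly n.+1 (\poly_(i < n.+2) f i)).
rewrite coef_deriv coef_exp_poly // coefM mulr_natl => ->.
apply: eq_bigr => i _; have := ltn_ord i => ni.
rewrite coef_exp_poly //; try lia.
by rewrite coef_deriv coef_poly ltnS ni mulr_natl.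
Qed.

(** Newton's identities: the logarithmic derivative of 1 - c X is
    - (c + c^2 X + c^3 X^2 + ...), here truncated at order m.  The error term
    'X^m * R keeps the statement an identity of polynomials, stable under
    products. *)
Lemma logder_prod m (s : seq K) : exists R : {poly K},
  (\prod_(c <- s) (1 - c *: 'X))^`() =
    (\poly_(i < m) (- \sum_(c <- s) c ^+ i.+1)) * \prod_(c <- s) (1 - c *: 'X) + 'X^m * R.
Proof.
elim: s => [|c s [R IH]].
  exists 0; rewrite !big_nil derivC mulr1 mulr0 addr0.
  by apply/polyP => i; rewrite coef0 coef_poly big_nil oppr0 if_same.
rewrite !big_cons; set Q := \prod_(_ <- s) _ in IH *.
set b := \poly_(i < m) _ in IH.
pose a : {poly K} := \poly_(i < m) (- c ^+ i.+1).
have aE : (1 - c *: 'X) * a = - c%:P + c ^+ m.+1 *: 'X^m.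
  rewrite /a; elim: m {b IH a} => [|m IHm].
    have -> : \poly_(i < 0) (- c ^+ i.+1) = 0 :> {poly K} by rewrite poly_def big_ord0.
    by rewrite mulr0 expr0 expr1 alg_polyC addNr.
  move: IHm; rewrite !poly_def => IHm.
  rewrite big_ord_recr /= mulrDr IHm scaleNr !exprS -!mul_polyC !polyCM.
  ring.
exists ((1 - c *: 'X) * R - c ^+ m.+1 *: Q).
have -> : \poly_(i < m) (- (\sum_(c0 <- c :: s) c0 ^+ i.+1)) = a + b.
  apply/polyP => i; rewrite coefD !coef_poly; case: ifP => _; last by rewrite addr0.
  by rewrite big_cons opprD.
rewrite derivM derivB derivC derivZ derivX sub0r IH.
transitivity (((1 - c *: 'X) * a - c ^+ m.+1 *: 'X^m) * Q
              + (1 - c *: 'X) * (b * Q + 'X^m * R)).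
  by rewrite aE alg_polyC; ring.
by rewrite -!mul_polyC; ring.
Qed.

(** Both sides satisfy the same recurrence, by [fps_exp_rec] and [logder_prod]. *)
Lemma fps_exp_log_prod (f : fps K) (s : seq K) : f 0%N = 0 ->
  (forall n, n.+1%:R * f n.+1 = - \sum_(c <- s) c ^+ n.+1) ->
  forall n, fps_exp f n = (\prod_(c <- s) (1 - c *: 'X))`_n.
Proof.
move=> f0 fE n; have [k] := ubnP n; elim: k n => // k IH [|n].
  move=> _; rewrite /fps_exp big_ord1 /= /fps_one eqxx fact0 divr1.
  rewrite -horner_coef0 horner_prod big1 // => c _.
  by rewrite !hornerE /= ?mulr0 ?subr0.
rewrite ltnS => nk; apply: (mulfI (char0 n)); rewrite fps_exp_rec //.
have [R dE] := logder_prod n.+1 s.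
have := congr1 (fun p : {poly K} => p`_n) dE; rewrite coef_deriv mulr_natl => ->.
rewrite coefD coefXnM ltnSn addr0 coefM; apply: eq_bigr => i _.
rewrite fE IH; last by have := ltn_ord i; lia.
by rewrite coef_poly ltn_ord.
Qed.

End Exp.

(** * Interpolation in m1 and m2 *)

Section Interpolation.
Variable K : fieldType.

Lemma poly_eq_inj (p r : {poly K}) (x : nat -> K) n :
  injective x -> (forall k, (n <= k)%N -> p.[x k] = r.[x k]) -> p = r.
Proof.
move=> xi e; apply/eqP; rewrite -subr_eq0; apply: contraT => ne.
have := max_poly_roots ne (rs := map x (iota n (size (p - r)))).
rewrite size_map size_iota ltnn map_inj_uniq ?iota_uniq // => H.
suff : false by []; apply: H => //.
apply/allP => _ /mapP[k + ->]; rewrite mem_iota => /andP[nk _].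
by rewrite rootE hornerD hornerN e // subrr.
Qed.

(** Interpolation takes place at infinitely many points, so that no bound on the
    degree has to be carried along. *)
Definition polyfun (h : K -> K) : Prop := exists p : {poly K}, forall x, h x = p.[x].

Lemma polyfun_eq (h k : K -> K) (x : nat -> K) n : polyfun h -> polyfun k ->
  injective x -> (forall i, (n <= i)%N -> h (x i) = k (x i)) -> h =1 k.
Proof.
move=> [p hp] [r kr] xi e y; rewrite hp kr; congr (_.[_]).
by apply: (poly_eq_inj xi (n := n)) => i ni; rewrite -hp -kr e.
Qed.

Lemma polyfun_const c : polyfun (fun _ => c).
Proof. by exists c%:P => x; rewrite hornerC. Qed.

Lemma polyfun_id : polyfun (fun x => x).
Proof. by exists 'X => x; rewrite hornerX. Qed.

Lemma polyfunD h k : polyfun h -> polyfun k -> polyfun (fun x => h x + k x).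
Proof. by move=> [p hp] [r kr]; exists (p + r) => x; rewrite hornerD hp kr. Qed.

Lemma polyfunM h k : polyfun h -> polyfun k -> polyfun (fun x => h x * k x).
Proof. by move=> [p hp] [r kr]; exists (p * r) => x; rewrite hornerM hp kr. Qed.

Lemma polyfunB h k : polyfun h -> polyfun k -> polyfun (fun x => h x - k x).
Proof. by move=> [p hp] [r kr]; exists (p - r) => x; rewrite hornerD hornerN hp kr. Qed.

Lemma polyfunX h n : polyfun h -> polyfun (fun x => h x ^+ n).
Proof. by move=> [p hp]; exists (p ^+ n) => x; rewrite horner_exp hp. Qed.

Lemma polyfun_ext h k : h =1 k -> polyfun k -> polyfun h.
Proof. by move=> e [p hp]; exists p => x; rewrite e. Qed.

Lemma polyfun_sum (I : Type) (r : seq I) (P : pred I) (F : I -> K -> K) :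
  (forall i, P i -> polyfun (F i)) -> polyfun (fun x => \sum_(i <- r | P i) F i x).
Proof.
move=> PF; elim: r => [|i r IH].
  by apply: (polyfun_ext _ (polyfun_const 0)) => x; rewrite big_nil.
have [Pi|Pi] := boolP (P i); last first.
  by apply: (polyfun_ext _ IH) => x; rewrite big_cons (negbTE Pi).
by apply: (polyfun_ext _ (polyfunD (PF i Pi) IH)) => x; rewrite big_cons Pi.
Qed.

Lemma polyfun_prod (I : Type) (r : seq I) (F : I -> K -> K) :
  (forall i, polyfun (F i)) -> polyfun (fun x => \prod_(i <- r) F i x).
Proof.
move=> PF; elim: r => [|i r IH].
  by apply: (polyfun_ext _ (polyfun_const 1)) => x; rewrite big_nil.
by apply: (polyfun_ext _ (polyfunM (PF i) IH)) => x; rewrite big_cons.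
Qed.

Lemma polyfun_fps_exp (f : K -> fps K) n :
  (forall i, polyfun (fun x => f x i)) -> polyfun (fun x => fps_exp (f x) n).
Proof.
move=> Pf; have pow k j : polyfun (fun x => fps_exp_nat (f x) k j).
  elim: k j => [|k IH] j; first exact: polyfun_const.
  by apply: polyfun_sum => i _; exact: (polyfunM (Pf _) (IH _)).
by apply: polyfun_sum => k _; exact: (polyfunM (pow _ _) (polyfun_const _)).
Qed.

End Interpolation.

Section GenericField.
Variables (K : fieldType) (t q : K).
Hypothesis gen : generic t q.
Hypothesis char0 : forall n, n.+1%:R != 0 :> K.

Lemma t_pow_inj : injective (fun k => t ^+ k).
Proof. by move=> a b e; have [] := @gen a 0 b 0 (congr1 (fun x => x * q ^+ 0) e). Qed.

Lemma q_pow_inj : injective (fun k => q ^+ k).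
Proof. by move=> a b e; have [] := @gen 0 a 0 b (congr1 ( *%R (t ^+ 0)) e). Qed.

Lemma one_sub_pow_neq0 (x : K) n : injective (fun k => x ^+ k) -> 1 - x ^+ n.+1 != 0.
Proof. by move=> xi; rewrite subr_eq0; apply/eqP; rewrite -(expr0 x) => /xi. Qed.

Definition box_chars N M : seq K := [seq q ^+ b * t ^+ a | b <- iota 0 M, a <- iota 0 N].

Definition box_poly N M : {poly K} := \prod_(c <- box_chars N M) (1 - c *: 'X).

(** Two geometric sums. *)
Lemma log_series_box N M n :
  n.+1%:R * log_series (t ^+ N) (q ^+ M) t^-1 q^-1 n.+1
  = - \sum_(c <- box_chars N M) c ^+ n.+1.
Proof.
rewrite /log_series !exprVn !invrK.
have geo (x : K) L : injective (fun k => x ^+ k) ->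
    (1 - (x ^+ L) ^+ n.+1) / (1 - x ^+ n.+1) = \sum_(0 <= a < L) (x ^+ a) ^+ n.+1.
  move=> xi; rewrite big_mkord; apply: (canLR (mulfK (one_sub_pow_neq0 n xi))).
  rewrite -exprM mulnC exprM -opprB subrX1 -mulNr opprB mulrC; congr (_ * _).
  by apply: eq_bigr => a _; rewrite -!exprM mulnC.
rewrite mulrA mulrN divff // mulN1r; congr (- _).
rewrite invfM mulrACA (geo _ _ t_pow_inj) (geo _ _ q_pow_inj) mulrC mulr_suml.
rewrite /box_chars big_allpairs_dep /index_iota !subn0; apply: eq_bigr => b _.
by rewrite mulr_sumr; apply: eq_bigr => a _; rewrite exprMn.
Qed.

(** [box_sumE] holds for every value of z, in particular at all powers of t. *)
Lemma box_poly_sum N M :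
  box_poly N M = \sum_(g : {ffun 'I_N -> 'I_M.+1} | nonincf g)
    shape_weight t q (q ^+ M) (fun i => g i) *: 'X^(\sum_(i < N) g i)%N.
Proof.
apply: (poly_eq_inj t_pow_inj (n := 0)) => k _; set z := t ^+ k.
have := box_sumE gen N M z; rewrite /box_sum => E.
rewrite horner_sum.
under [RHS]eq_bigr => g _ do rewrite hornerZ hornerXn mulrC.
rewrite E /box_poly horner_prod /box_chars big_allpairs_dep.
rewrite -[X in _ = X](big_mkord predT (fun b => \prod_(a < N) (1 - z * q ^+ b * t ^+ a))).
rewrite /index_iota subn0; apply: eq_bigr => b _.
rewrite -(big_mkord predT (fun a => 1 - z * q ^+ b * t ^+ a)) /index_iota subn0.
by apply: eq_bigr => a _; rewrite !hornerE; ring.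
Qed.

Lemma box_poly_coef N M n : (box_poly N M)`_n =
  \sum_(g : {ffun 'I_N -> 'I_M.+1} | profile n g)
    shape_weight t q (q ^+ M) (fun i => g i).
Proof.
rewrite box_poly_sum coef_sum /profile [RHS]big_mkcondr /=.
apply: eq_bigr => g _; rewrite coefZ coefXn eq_sym.
by case: eqP => _; rewrite ?mulr1 ?mulr0.
Qed.

Lemma shape_weight_ext N v (l l' : 'I_N -> nat) : l =1 l' ->
  shape_weight t q v l = shape_weight t q v l'.
Proof.
move=> e; rewrite /shape_weight; congr (_ * _).
  by apply: eq_bigr => i _; rewrite e.
by apply: eq_bigr => i _; apply: eq_bigr => j _; rewrite !e.
Qed.

Lemma genF_y0 m1 m2 m3 n : genF t^-1 q^-1 m1 m2 m3 n 0 =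
  \sum_(l : {bseq n of 'I_n.+1} | fits l)
    (-1) ^+ n * (Lambda t^-1 q^-1 m1 (dual (taut (map val l)))
      * Lambda t^-1 q^-1 m2 (dual (taut (map val l)))
      * ext_pow t^-1 q^-1 n (taut (map val l)))
    / \prod_(w <- dual (tangent (map val l))) (1 - ev t^-1 q^-1 w).
Proof.
rewrite /genF /chi mulr_sumr; apply: eq_bigr => l _.
by rewrite integrand_y0 mulrA.
Qed.

Lemma genF_y0_box N M m3 n : (n <= N)%N -> (n <= M)%N ->
  genF t^-1 q^-1 (t ^+ N) (q ^+ M) m3 n 0 = (box_poly N M)`_n.
Proof.
move=> nN nM; rewrite box_poly_coef (fits_reindex nN nM) genF_y0.
apply: eq_bigr => l fl; have /andP[pl /eqP sl] := fl.
have := fixed_point_contribution gen (q ^+ M) pl (size_bseq_parts nN l).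
rewrite sl => ->.
by apply: shape_weight_ext => i; rewrite rows_ofE.
Qed.

(** Interpolate first in m2 along the powers of q, with m1 = t^N fixed, and then
    in m1 along the powers of t. *)
Lemma genF_y0_generic m1 m2 m3 n :
  genF t^-1 q^-1 m1 m2 m3 n 0 = fps_exp (log_series m1 m2 t^-1 q^-1) n.
Proof.
have PL V : polyfun (fun m => Lambda t^-1 q^-1 m V).
  apply: (polyfun_ext (fun m => LambdaE t^-1 q^-1 m V)); apply: polyfun_prod => w.
  exact: (polyfunB (polyfun_const _) (polyfunM (@polyfun_id K) (polyfun_const _))).
have PX k : polyfun (fun m : K => 1 - m ^+ k).
  exact: (polyfunB (polyfun_const _) (polyfunX _ (@polyfun_id K))).
have PC := @polyfun_const K.
have box N M : (n <= N)%N -> (n <= M)%N ->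
    genF t^-1 q^-1 (t ^+ N) (q ^+ M) m3 n 0
    = fps_exp (log_series (t ^+ N) (q ^+ M) t^-1 q^-1) n.
  move=> nN nM; rewrite genF_y0_box //.
  by rewrite (fps_exp_log_prod char0 (s := box_chars N M)) //; apply: log_series_box.
have half N : (n <= N)%N -> genF t^-1 q^-1 (t ^+ N) m2 m3 n 0
    = fps_exp (log_series (t ^+ N) m2 t^-1 q^-1) n.
  move=> nN; apply: (@polyfun_eq K (fun m => genF _ _ _ m _ _ _)
    (fun m => fps_exp (log_series _ m _ _) n) _ n _ _ q_pow_inj) => [||M nM];
    last exact: box.
  - apply: (polyfun_ext (fun m => genF_y0 _ m m3 n)); apply: polyfun_sum => l _.
    apply: (polyfunM _ (PC _)); apply: (polyfunM (PC _)).
    exact: (polyfunM (polyfunM (PC _) (PL _)) (PC _)).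
  - apply: polyfun_fps_exp => -[|i]; first exact: PC.
    exact: (polyfunM (PC _) (polyfunM (polyfunM (PC _) (PX _)) (PC _))).
apply: (@polyfun_eq K (fun m => genF _ _ m _ _ _ _)
    (fun m => fps_exp (log_series m _ _ _) n) _ n _ _ t_pow_inj) => [||N nN];
  last exact: half.
- apply: (polyfun_ext (fun m => genF_y0 m _ m3 n)); apply: polyfun_sum => l _.
  apply: (polyfunM _ (PC _)); apply: (polyfunM (PC _)).
  exact: (polyfunM (polyfunM (PL _) (PC _)) (PC _)).
- apply: polyfun_fps_exp => -[|i]; first exact: PC.
  exact: (polyfunM (PC _) (polyfunM (polyfunM (PX _) (PC _)) (PC _))).
Qed.

End GenericField.

(** * Rational functions in five variables *)

Section RationalFunctions.
Variable C : numClosedFieldType.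

Lemma ratfun_char0 n : n.+1%:R != 0 :> ratfun C.
Proof.
rewrite -(rmorph_nat (@FracField.tofrac {mpoly C[5]})) tofrac_eq0.
by rewrite -mpolyC_nat mpolyC_eq0 Num.Theory.pnatr_eq0.
Qed.

Lemma generic_inv (K : fieldType) (t1 t2 : K) : generic t1 t2 -> generic t1^-1 t2^-1.
Proof. by move=> g a b c d; rewrite !exprVn -!invfM => /invr_inj /g. Qed.

(** Distinct monomials are distinct polynomials, and polynomials embed in their
    field of fractions. *)
Lemma generic_vt : generic (vt1 C) (vt2 C).
Proof.
move=> a b c d; rewrite /vt1 /vt2 /rvar -!rmorphXn -!rmorphM /=.
move=> /eqP; rewrite tofrac_eq => /eqP.
pose i1 := Ordinal (isT : 3 < 5)%N; pose i2 := Ordinal (isT : 4 < 5)%N.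
rewrite !mpolyXn -!mpolyXD => /(congr1 (mcoeff (U_(i1) *+ c + U_(i2) *+ d)%MM)).
rewrite !mcoeffX eqxx; case: eqP => [e _ | _ /eqP]; last by rewrite eq_sym oner_eq0.
have := congr1 (fun m : 'X_{1..5} => m i1) e.
have := congr1 (fun m : 'X_{1..5} => m i2) e.
by rewrite !mnmDE !mulmnE !mnm1E /=; lia.
Qed.

End RationalFunctions.

Theorem proposition1p3 (C : numClosedFieldType) :
  at_y0 (genF (vt1 C) (vt2 C) (vm1 C) (vm2 C) (vm3 C))
  =1 fps_exp (log_series (vm1 C) (vm2 C) (vt1 C) (vt2 C)).
Proof.
move=> n; rewrite /at_y0.
have := genF_y0_generic (generic_inv (@generic_vt C)) (@ratfun_char0 C)
  (vm1 C) (vm2 C) (vm3 C) n.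
by rewrite !invrK.
Qed.
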